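(* Let $K\ge 1$ and let $\lambda_1,\dots,\lambda_K>0$. Let $\eta_1,\dots,\eta_K$ be independent random variables with $\eta_i\sim\mathrm{Ga}(\lambda_i,1)$, i.e. with density $\eta^{\lambda_i-1}e^{-\eta}/\Gamma(\lambda_i)$ on $(0,\infty)$. Then: (i) if $\Psi=\prod_{i=1}^K \eta_i$, the sparsity shape parameter of $\Psi$ equals $\min\{\lambda_1,\dots,\lambda_K\}$; (ii) if $\Psi=\sum_{i=1}^K \eta_i$, the sparsity shape parameter of $\Psi$ equals $\sum_{i=1}^K \lambda_i$.
   Context: For a positive random variable $\Psi$ with density $p$ on $(0,\infty)$, its sparsity shape parameter is defined as $$\sup\left\{ z \;\middle|\; \frac{p(\Psi)}{\Psi^{z-1}}\to \kappa \text{ as } \Psi\to 0 \text{ for some finite } \kappa\right\}.$$ *)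

(* Defs.v *)
From HB Require Import structures.
From mathcomp Require Import all_boot all_order all_algebra.
From mathcomp Require Import all_classical all_reals all_analysis.
Set Implicit Arguments. Unset Strict Implicit. Unset Printing Implicit Defensive.
Import Order.TTheory GRing.Theory Num.Theory.
Import numFieldNormedType.Exports.
Local Open Scope classical_set_scope.
Local Open Scope ring_scope.

Definition Gamma_fun {R : realType} (a : R) : R :=
  Rintegral (@lebesgue_measure R) `]0%R, +oo[ (fun x => x `^ (a - 1) * expR (- x)).

Definition gamma_pdf {R : realType} (a : R) (x : R) : R :=
  if 0 < x then x `^ (a - 1) * expR (- x) / Gamma_fun a else 0.

Definition has_density_pos {R : realType} {d : measure_display}
  {T : measurableType d} (P : probability T R) (X : T -> R) (p : R -> R) : Prop :=
  forall A : set R, measurable A ->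
    P (X @^-1` A) = (\int[@lebesgue_measure R]_(x in A `&` (`]0%R, +oo[ : set R)) (p x)%:E)%E.

(* Mutual independence of the finite family X_0, ..., X_{K-1} of real random
   variables: product rule for every family of Borel sets (taking B_i = setT
   recovers every subfamily). *)
Definition mutually_independent {R : realType} {d : measure_display}
  {T : measurableType d} (P : probability T R) (K : nat) (X : 'I_K -> T -> R) : Prop :=
  forall B : 'I_K -> set R, (forall i, measurable (B i)) ->
    P (\bigcap_(i in [set: 'I_K]) (X i @^-1` B i)) = (\prod_(i < K) P (X i @^-1` B i))%E.

(* Sparsity shape parameter of a positive random variable with density p:
   sup { z | p(psi)/psi^(z-1) -> kappa as psi -> 0+ for some finite kappa }
   (as an extended real, so that it is always defined). *)
Definition sparsity_shape {R : realType} (p : R -> R) : \bar R :=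
  ereal_sup [set z%:E | z in [set z : R | exists kappa : R,
     (fun x : R => p x / x `^ (z - 1)) x @[x --> 0^'+] --> kappa]].

(* Main.v *)
(** In an independent family the first two members can be merged into one, so
    the factors can be absorbed one gamma variable at a time.

    For a product, the new density is the integral of [f (x / v) g v / v] over
    [v > 0].  Call [f] of class [m] if it is continuous, at least [c x^(m-1)] on
    (0, 1], and at most [C x^(z-1)] for each 0 < z < m.  Absorbing a gamma
    variable of shape [b] turns class [m] into class [min m b], and a density of
    class [m] has sparsity shape parameter [m]; these bounds are loose enough to
    tolerate the logarithmic factors that appear when shapes coincide.

    For a sum, the substitution [v = x t] turns the convolution of the kernels of
    shapes [a] and [b] into the kernel of shape [a + b] times a Beta integral.
    Its value is irrelevant: the total mass being 1 forces it to be finite and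
    positive.

    Finally a density that is continuous on (0, oo) is determined by the law, so
    every such density agrees with the one constructed. *)
Require Import Defs.
From HB Require Import structures.
From mathcomp Require Import all_boot all_order all_algebra.
From mathcomp Require Import all_classical all_reals all_analysis.
From mathcomp Require Import measurable_realfun ring lra.
Import Order.TTheory GRing.Theory Num.Theory.
Import numFieldNormedType.Exports.
Import HBNNSimple.
Local Open Scope classical_set_scope.
Local Open Scope ring_scope.

(** * Integrals against affine images and densities *)

Section change_of_variables.
Context {R : realType}.
Local Notation mu := (@lebesgue_measure R).
Local Open Scope ereal_scope.

Let affine (a b : R) (x : measurableTypeR R) : measurableTypeR R := (a * x + b)%R.

Let measurable_affine a b : measurable_fun [set: measurableTypeR R] (affine a b).
Proof. by apply: measurable_funD => //; exact: measurable_funM. Qed.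

Let scaled_affine a b : {measure set (measurableTypeR R) -> \bar R} :=
  mscale a (measure_function_pushforward__canonical__measure_function_Measure
    mu (measurable_affine a%:num b)).

(** By uniqueness of Lebesgue measure it suffices to test half-open intervals: the preimage of []u,
    v]] has length (v - u) / a, and scaling by a restores v - u. *)
Let scaled_affineE (a : {nonneg R}) (b : R) : (0 < a%:num)%R ->
  forall A, measurable A -> mu A = scaled_affine a b A.
Proof.
move=> a0 A mA; apply: lebesgue_measure_unique => //= _ [[u v]] _ <-.
rewrite /scaled_affine /mscale /= /pushforward.
rewrite (_ : _ @^-1` _ = `](u - b) / a%:num, (v - b) / a%:num]%classic)%R; last first.
  apply/seteqP; split=> x /=; rewrite /affine !in_itv/= ltr_pdivrMr// ler_pdivlMr//
    => /andP[h1 h2]; apply/andP; split; lra.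
rewrite !lebesgue_measure_itv/= !lte_fin ltr_pM2r ?invr_gt0// ltrD2r.
case: ifPn => // _; rewrite ?mule0// -!EFinB -EFinM; congr EFin; field.
by rewrite gt_eqF.
Qed.

Lemma ge0_integral_affine (a b : R) (f : R -> \bar R) : (0 < a)%R ->
  measurable_fun [set: R] f -> (forall x, 0 <= f x) ->
  \int[mu]_x f x = a%:E * \int[mu]_x f (a * x + b)%R.
Proof.
move=> a0 mf f0.
rewrite (eq_measure_integral (scaled_affine (NngNum (ltW a0)) b)); last first.
  by move=> A mA _; rewrite -scaled_affineE.
by rewrite ge0_integral_mscale//= ge0_integral_pushforward.
Qed.

(** By monotone convergence both sides are limits along the simple functions [f_ n], for which the
    claim reduces to [mE] on each level set. *)
Lemma ge0_integral_density (m : {measure set R -> \bar R}) (g : R -> R) :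
  measurable_fun [set: R] g -> (forall x, 0 <= g x)%R ->
  (forall A, measurable A -> m A = \int[mu]_(x in A) (g x)%:E) ->
  forall F : R -> \bar R, measurable_fun [set: R] F -> (forall x, 0 <= F x) ->
  \int[m]_x F x = \int[mu]_x (F x * (g x)%:E).
Proof.
move=> mg g0 mE F mF F0.
pose f_ := nnsfun_approx measurableT mF.
have mf n : measurable_fun [set: R] (EFin \o f_ n) by exact/measurable_EFinP.
have ndf x a b : (a <= b)%N -> (f_ a x <= f_ b x)%R.
  by move=> ab; exact/lefP/nd_nnsfun_approx.
transitivity (limn (fun n => \int[m]_x (f_ n x)%:E)).
  rewrite -monotone_convergence//=.
  - by apply: eq_integral => x _; apply/esym/cvg_lim => //=; exact: cvg_nnsfun_approx.
  - by move=> n x _; rewrite lee_fin.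
  - by move=> x _ a b ab; rewrite lee_fin ndf.
transitivity (limn (fun n => \int[mu]_x ((f_ n x)%:E * (g x)%:E))); last first.
  rewrite -monotone_convergence//=.
  - apply: eq_integral => x _; apply/cvg_lim => //=.
    have cf : (f_ n x)%:E @[n --> \oo] --> F x by exact: cvg_nnsfun_approx.
    exact: cvgeZr cf.
  - by move=> n; apply: emeasurable_funM; [exact: mf|exact/measurable_EFinP].
  - by move=> n x _; rewrite mule_ge0// lee_fin.
  - by move=> x _ a b ab; rewrite lee_wpmul2r// lee_fin ?ndf ?g0.
congr (limn _); apply/funext => n.
have mI r : measurable_fun [set: R] (fun x => (r * \1_(f_ n @^-1` [set r]) x)%:E).
  by apply/measurable_EFinP/measurable_funM => //; exact: measurable_indic.
under eq_integral do rewrite fimfunE -fsumEFin//.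
rewrite ge0_integral_fsum//; last first.
  by move=> r x _; rewrite EFinM nnfun_muleindic_ge0.
under [RHS]eq_integral => x _.
  rewrite fimfunE -fsumEFin// ge0_mule_fsuml; last first.
    by move=> r; rewrite EFinM nnfun_muleindic_ge0.
  over.
rewrite [RHS]ge0_integral_fsum//; last 2 first.
  - move=> r; apply: emeasurable_funM; last exact/measurable_EFinP.
    exact: mI.
  - by move=> r x _; rewrite mule_ge0// ?EFinM ?nnfun_muleindic_ge0 ?lee_fin.
apply: eq_fsbigr => r rr.
have r0 : (0 <= r)%R by move: rr; rewrite inE => -[x _ <-].
rewrite integralZl_indic_nnsfun//= integral_indic//= setIT mE//.
under [RHS]eq_integral do rewrite EFinM -muleA.
rewrite ge0_integralZl//; last 2 first.
  - apply: emeasurable_funM; apply/measurable_EFinP => //.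
    have mA : measurable (f_ n @^-1` [set r]) by exact: measurable_sfunP.
    exact: (@measurable_indic _ R R).
  - by move=> x _; rewrite mule_ge0// lee_fin.
congr (_ * _); rewrite [LHS]integral_mkcond; apply: eq_integral => x _.
by rewrite patchE indicE; case: ifPn; rewrite ?mul1e ?mul0e.
Qed.

End change_of_variables.

(** * Independence *)

Section joint_law.
Context {R : realType} {d} {T : measurableType d} (P : probability T R).
Local Open Scope ereal_scope.

(* Uniqueness of the product measure is applied to the joint law conditioned on
   [E], which is why the case [P E = 0] is treated apart. *)
Lemma independent_pair_law (U V : {mfun T >-> R}) (E : set T) : measurable E ->
  (forall A B, measurable A -> measurable B ->
    P (U @^-1` A `&` V @^-1` B `&` E) = P (U @^-1` A) * P (V @^-1` B) * P E) ->
  forall C : set (R * R), measurable C ->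
    P ((fun w => (U w, V w)) @^-1` C `&` E) =
    (distribution P U \x distribution P V) C * P E.
Proof.
move=> mE ind C mC.
have mUV : measurable_fun [set: T] (fun w => (U w, V w)).
  exact: measurable_fun_pair.
have mCE : measurable ((fun w => (U w, V w)) @^-1` C).
  by rewrite -[X in measurable X]setTI; exact: mUV.
have [PE0|PE0] := eqVneq (P E) 0.
  rewrite PE0 mule0; apply/eqP; rewrite -measure_le0 -[leRHS]PE0.
  by rewrite le_measure ?inE//; exact: measurableI.
have PEfin : P E \is a fin_num by exact: fin_num_measure.
have PE_gt0 : (0 < fine (P E))%R.
  by rewrite fine_gt0// lt0e PE0 measure_ge0/= ltey_eq PEfin.
have ile : (0 <= (fine (P E))^-1)%R by rewrite invr_ge0 ltW.
pose m : {measure set (R * R) -> \bar R} := mscale (NngNum ile)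
  (measure_function_pushforward__canonical__measure_function_Measure (mrestr P mE) mUV).
have mm X : m X = (fine (P E))^-1%:E * P ((fun w => (U w, V w)) @^-1` X `&` E) by [].
rewrite (@product_measure_unique _ _ _ _ _ _ _ m)//.
  by rewrite mm muleAC -{2}(fineK PEfin) -EFinM mulVf ?gt_eqF// mul1e.
move=> A B mA mB; rewrite mm.
rewrite (_ : _ @^-1` (A `*` B) = U @^-1` A `&` V @^-1` B)//.
by rewrite ind// muleC -muleA -{1}(fineK PEfin) -EFinM mulfV ?gt_eqF// mule1.
Qed.

(** For fixed v > 0, [phi (v, x)] is the density in x of [op U v], as the hypothesis tested on
    indicators expresses. Since [g] vanishes on v <= 0, integrating over the law of [V] and
    exchanging the integrals by Tonelli gives the density of the combination. *)
Lemma independent_density (U V : {mfun T >-> R}) (op : R -> R -> R)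
    (f g : R -> R) (phi : R * R -> R) :
  measurable_fun [set: R * R] (fun z => op z.1 z.2) ->
  (forall A B, measurable A -> measurable B ->
    P (U @^-1` A `&` V @^-1` B) = P (U @^-1` A) * P (V @^-1` B)) ->
  (forall A, measurable A -> P (U @^-1` A) = \int[lebesgue_measure]_(x in A) (f x)%:E) ->
  (forall A, measurable A -> P (V @^-1` A) = \int[lebesgue_measure]_(x in A) (g x)%:E) ->
  measurable_fun [set: R] f -> measurable_fun [set: R] g ->
  (forall x, 0 <= f x)%R -> (forall x, 0 <= g x)%R ->
  (forall x, x <= 0 -> g x = 0)%R ->
  measurable_fun [set: R * R] phi -> (forall z, 0 <= phi z)%R ->
  (forall v A, (0 < v)%R -> measurable A ->
    \int[lebesgue_measure]_x (f x * \1_A (op x v))%:E =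
    \int[lebesgue_measure]_x (phi (v, x) * \1_A x)%:E) ->
  forall A, measurable A ->
    P ((fun w => op (U w) (V w)) @^-1` A) =
    \int[lebesgue_measure]_(x in A) \int[lebesgue_measure]_v (phi (v, x) * g v)%:E.
Proof.
move=> mop ind fE gE mf mg f0 g0 gN mphi phi0 phiE A mA.
have mop' : measurable_fun [set: R * R] (fun z => op z.2 z.1).
  have ms : measurable_fun [set: R * R] (fun z : R * R => (z.2, z.1)).
    by apply: measurable_fun_pair; [exact: measurable_snd|exact: measurable_fst].
  exact: (measurableT_comp mop ms).
(* The coordinates are swapped so that [V] comes first and [xsection C v] is the set of x with
   [op x v] in [A]. *)
pose C := (fun z : R * R => op z.2 z.1) @^-1` A.
have mC : measurable C by rewrite -[X in measurable X]setTI; exact: mop'.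
have indVU B B' : measurable B -> measurable B' ->
    P (V @^-1` B `&` U @^-1` B' `&` setT) = P (V @^-1` B) * P (U @^-1` B') * P setT.
  by move=> mB mB'; rewrite setIT probability_setT mule1 setIC ind// muleC.
have := independent_pair_law _ _ _ measurableT indVU _ mC.
rewrite setIT probability_setT mule1 => ->.
transitivity (\int[distribution P V]_v (distribution P U (xsection C v))) => //.
have mGx : measurable_fun [set: R] (fun v => distribution P U (xsection C v)).
  exact: measurable_fun_xsection.
rewrite (ge0_integral_density _ _ mg g0)//.
transitivity (\int[lebesgue_measure]_v \int[lebesgue_measure]_x
   (phi (v, x) * \1_A x * g v)%:E).
  apply: eq_integral => v _.
  have [v0|v0] := leP v 0%R.
    rewrite gN// mule0 integral0_eq// => x _; by rewrite mulr0.
  under [RHS]eq_integral do rewrite EFinM.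
  have mphi1 : measurable_fun [set: R] (fun x => phi (v, x) * \1_A x)%R.
    apply: measurable_funM; last exact: (@measurable_indic _ R R).
    by apply: measurableT_comp => //; exact: measurable_pair1.
  rewrite ge0_integralZr//; last 3 first.
    - exact/measurable_EFinP.
    - by move=> x _; rewrite lee_fin mulr_ge0.
    - by rewrite lee_fin.
  congr (_ * _); rewrite -phiE//.
  rewrite /distribution /pushforward fE//; last exact: measurable_xsection.
  rewrite [LHS]integral_mkcond; apply: eq_integral => x _.
  rewrite patchE mem_xsection indicE.
  have -> : ((v, x) \in C) = (op x v \in A) by apply/idP/idP; rewrite !inE.
  by case: ifPn; rewrite ?mulr1 ?mulr0.
have mF : measurable_fun [set: R * R] (fun z : R * R => (phi z * \1_A z.2 * g z.1)%:E).
  apply/measurable_EFinP; apply: measurable_funM; last first.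
    by apply: measurableT_comp => //; exact: measurable_fst.
  apply: measurable_funM => //.
  have mI : measurable_fun [set: R] (\1_A : R -> R) by exact: (@measurable_indic _ R R).
  exact: (measurableT_comp mI measurable_snd).
have F0 (z : R * R) : 0 <= (phi z * \1_A z.2 * g z.1)%:E by rewrite lee_fin !mulr_ge0.
etransitivity; first exact: (@fubini_tonelli _ _ _ _ _
  (@lebesgue_measure R) (@lebesgue_measure R) _ mF F0).
rewrite [RHS]integral_mkcond.
apply: eq_integral => x _; rewrite patchE /= indicE; case: ifPn => xA.
  by under eq_integral do rewrite mulr1.
by rewrite integral0_eq// => v _; rewrite mulr0 mul0r.
Qed.

End joint_law.

Lemma bigcap_ord_recl {T : Type} (n : nat) (F : 'I_n.+1 -> set T) :
  \bigcap_(i in [set: 'I_n.+1]) F i =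
  F ord0 `&` \bigcap_(i in [set: 'I_n]) F (lift ord0 i).
Proof.
apply/seteqP; split=> [w Fw|w [F0 Fw] i _].
  by split=> [|i _]; exact: Fw.
by case: (unliftP ord0 i) => [j ->|->//]; exact: Fw.
Qed.

(** * Merging the first two members of an independent family *)

Section merging.
Context {R : realType} {d} {T : measurableType d} (P : probability T R).

Definition merge (op : R -> R -> R) n (X : 'I_n.+2 -> T -> R) (i : 'I_n.+1) : T -> R :=
  if unlift ord0 i is Some j then X (lift ord0 (lift ord0 j))
  else fun w => op (X ord0 w) (X (lift ord0 ord0) w).

Lemma merge0 op n (X : 'I_n.+2 -> T -> R) :
  merge op n X ord0 = fun w => op (X ord0 w) (X (lift ord0 ord0) w).
Proof. by rewrite /merge unlift_none. Qed.

Lemma merge_lift op n (X : 'I_n.+2 -> T -> R) i :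
  merge op n X (lift ord0 i) = X (lift ord0 (lift ord0 i)).
Proof. by rewrite /merge liftK. Qed.

(** The product rule is applied to the family [BB] made of [A], [A'] and the [B i]; choosing [setT]
    for both [A] and [A'] yields the probability of [E]. *)
Lemma independent_first2 n (X : 'I_n.+2 -> T -> R) (B : 'I_n -> set R) :
  mutually_independent P X -> (forall i, measurable (B i)) ->
  let E := \bigcap_(i in [set: 'I_n]) (X (lift ord0 (lift ord0 i)) @^-1` B i) in
  (P E = \prod_(i < n) P (X (lift ord0 (lift ord0 i)) @^-1` B i) /\
  forall A A', measurable A -> measurable A' ->
    P (X ord0 @^-1` A `&` X (lift ord0 ord0) @^-1` A' `&` E) =
    P (X ord0 @^-1` A) * P (X (lift ord0 ord0) @^-1` A') * P E)%E.
Proof.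
move=> indX mB E.
pose BB A A' (i : 'I_n.+2) : set R :=
  if unlift ord0 i is Some j then
    if unlift ord0 j is Some k then B k else A'
  else A.
have indE A A' : measurable A -> measurable A' ->
    (P (X ord0 @^-1` A `&` X (lift ord0 ord0) @^-1` A' `&` E) =
    P (X ord0 @^-1` A) * (P (X (lift ord0 ord0) @^-1` A') *
      \prod_(i < n) P (X (lift ord0 (lift ord0 i)) @^-1` B i)))%E.
  move=> mA mA'.
  have mBB i : measurable (BB A A' i).
    rewrite /BB; case: (unliftP ord0 i) => [j _|_//].
    by case: (unliftP ord0 j).
  have := indX _ mBB; rewrite !bigcap_ord_recl !big_ord_recl setIA.
  rewrite /BB unlift_none liftK unlift_none.
  under eq_bigcapr do rewrite !liftK.
  by under [in X in _ = X -> _]eq_bigr do rewrite !liftK.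
have PE : (P E = \prod_(i < n) P (X (lift ord0 (lift ord0 i)) @^-1` B i))%E.
  have := indE _ _ measurableT measurableT.
  by rewrite !preimage_setT !setTI probability_setT !mul1e.
by split=> // A A' mA mA'; rewrite indE// -PE muleA.
Qed.

(** The first two variables, as a pair, follow the product law both on the event [E] and on the
    whole space; comparing the two formulas for the same [C] splits off the factor [P E]. *)
Lemma independent_merge (op : R -> R -> R) n (X : 'I_n.+2 -> T -> R) :
  measurable_fun [set: R * R] (fun z => op z.1 z.2) ->
  (forall i, measurable_fun [set: T] (X i)) ->
  mutually_independent P X -> mutually_independent P (merge op n X).
Proof.
move=> mop mX indX B mB.
pose U : {mfun T >-> R} := HB.pack (X ord0)
  (isMeasurableFun.Build _ _ _ _ (X ord0) (mX ord0)).
pose V : {mfun T >-> R} := HB.pack (X (lift ord0 ord0))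
  (isMeasurableFun.Build _ _ _ _ (X (lift ord0 ord0)) (mX (lift ord0 ord0))).
have [PE indE] := independent_first2 n X (fun i => B (lift ord0 i)) indX (fun i => mB _).
have [_ indT] := independent_first2 n X (fun=> setT) indX (fun=> measurableT).
rewrite bigcap_ord_recl big_ord_recl merge0.
under eq_bigcapr do rewrite merge_lift.
under eq_bigr do rewrite merge_lift.
move: PE indE; set E := bigcap _ _ => PE indE; rewrite -PE.
pose C := (fun z : R * R => op z.1 z.2) @^-1` B ord0.
have mC : measurable C by rewrite -[X in measurable X]setTI; exact: mop.
have mE : measurable E.
  apply: fin_bigcap_measurable => [|i _]; first exact: finite_finset.
  by rewrite -[X in measurable X]setTI; exact: (mX _).
have h1 := independent_pair_law P U V E mE indE C mC.
have h2 : P ((fun w => (U w, V w)) @^-1` C `&` setT) =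
   (((distribution P U \x distribution P V) C) * P setT)%E.
  apply: (independent_pair_law P U V setT measurableT) => // A A' mA mA'.
  have := indT A A' mA mA'.
  rewrite (_ : \bigcap_(i in _) _ = setT)//.
  by apply/seteqP; split.
by rewrite setIT probability_setT mule1 in h2; rewrite h1 -h2.
Qed.

End merging.

(** * Densities of iterated combinations of independent variables *)

Section density_of_fold.
Context {R : realType} {d} {T : measurableType d} (P : probability T R).

(** Living on the whole line and vanishing for x <= 0, such a density can be integrated without a
    domain, so affine substitutions apply directly. *)
Definition full_density (X : T -> R) (f : R -> R) : Prop :=
  [/\ measurable_fun [set: R] f, forall x, 0 <= f x, forall x, x <= 0 -> f x = 0 &
    forall A, measurable A ->
      P (X @^-1` A) = (\int[lebesgue_measure]_(x in A) (f x)%:E)%E].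

(** This is the induction shared by products and sums. [D] describes the density accumulated so far
    and [G] that of one new variable, each with a label in a monoid. The first two variables are
    merged and the induction hypothesis is applied to the shorter family; associativity of [op] and
    [comb] restores the original folds. *)
Lemma density_big (idx : R) (op : Monoid.law idx) (M : Type) (idm : M)
    (comb : Monoid.law idm) (D G : M -> (R -> R) -> Prop) :
  measurable_fun [set: R * R] (fun z => op z.1 z.2) ->
  (forall (U V : {mfun T >-> R}) m m' f g,
    (forall A B, measurable A -> measurable B ->
      P (U @^-1` A `&` V @^-1` B) = (P (U @^-1` A) * P (V @^-1` B))%E) ->
    full_density U f -> full_density V g -> D m f -> G m' g ->
    exists h, full_density (fun w => op (U w) (V w)) h /\ D (comb m m') h) ->
  forall n (X : 'I_n.+1 -> T -> R) (m : 'I_n.+1 -> M),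
    (forall i, measurable_fun [set: T] (X i)) ->
    mutually_independent P X ->
    (exists f, full_density (X ord0) f /\ D (m ord0) f) ->
    (forall i : 'I_n, exists g, full_density (X (lift ord0 i)) g /\ G (m (lift ord0 i)) g) ->
    exists h, full_density (fun w => \big[op/idx]_(i < n.+1) X i w) h /\
      D (\big[comb/idm]_(i < n.+1) m i) h.
Proof.
move=> mop step; elim=> [|n IH] X m mX indX Xf Xg.
  have [f [Xf1 Df]] := Xf.
  exists f; rewrite big_ord1; split=> //.
  by rewrite (_ : (fun w => _) = X ord0)//; apply/funext => w; rewrite big_ord1.
have [f [X0f Df]] := Xf; have [g [X1g Gg]] := Xg ord0.
pose U : {mfun T >-> R} := HB.pack (X ord0)
  (isMeasurableFun.Build _ _ _ _ (X ord0) (mX ord0)).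
pose V : {mfun T >-> R} := HB.pack (X (lift ord0 ord0))
  (isMeasurableFun.Build _ _ _ _ (X (lift ord0 ord0)) (mX (lift ord0 ord0))).
have [_ indT] := independent_first2 P n X (fun=> setT) indX (fun=> measurableT).
have indUV A B : measurable A -> measurable B ->
      P (U @^-1` A `&` V @^-1` B) = (P (U @^-1` A) * P (V @^-1` B))%E.
  move=> mA mB; have := indT A B mA mB.
  rewrite (_ : \bigcap_(i in _) _ = setT) ?setIT ?probability_setT ?mule1//.
  by apply/seteqP; split.
have [h [dh Dh]] := step U V _ _ _ _ indUV X0f X1g Df Gg.
(* The labels are merged in parallel with the variables. *)
pose m' (i : 'I_n.+1) := if unlift ord0 i is Some j then m (lift ord0 (lift ord0 j))
  else comb (m ord0) (m (lift ord0 ord0)).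
have [i|||i|h' []] := IH (merge op n X) m'.
- case: (unliftP ord0 i) => [j ->|->]; first by rewrite merge_lift; exact: (mX _).
  rewrite merge0.
  have mXX : measurable_fun [set: T] (fun w => (X ord0 w, X (lift ord0 ord0) w)).
    exact: measurable_fun_pair.
  exact: (measurableT_comp mop mXX).
- exact: independent_merge.
- by exists h; rewrite merge0 /m' unlift_none.
- by have [g' ?] := Xg (lift ord0 i); exists g'; rewrite merge_lift /m' liftK.
rewrite big_ord_recl {1}/m' unlift_none.
under eq_bigr do rewrite /m' liftK.
move=> dh' Dh'; exists h'; rewrite !big_ord_recl Monoid.mulmA; split=> //.
rewrite (_ : (fun w => _) = (fun w => \big[op/idx]_(i < n.+1) merge op n X i w))//.
apply/funext => w; rewrite !big_ord_recl merge0 Monoid.mulmA; congr (op _ _).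
by apply: eq_bigr => i _; rewrite merge_lift.
Qed.

End density_of_fold.

(** * Gamma kernels *)

Section gamma_kernel.
Context {R : realType}.
Local Notation mu := (@lebesgue_measure R).

(** The gamma density without its normalising constant; constants are carried separately, so no
    value of the Gamma function is ever computed. *)
Definition gamma_kernel (a x : R) : R :=
  if 0 < x then x `^ (a - 1) * expR (- x) else 0.

Lemma gamma_kernel_ge0 a x : 0 <= gamma_kernel a x.
Proof. by rewrite /gamma_kernel; case: ifP => // _; rewrite mulr_ge0 ?powR_ge0 ?expR_ge0. Qed.

Lemma gamma_kernel_le0 a x : x <= 0 -> gamma_kernel a x = 0.
Proof. by rewrite /gamma_kernel ltNge => ->. Qed.

Lemma gamma_kernelE a x : 0 < x -> gamma_kernel a x = x `^ (a - 1) * expR (- x).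
Proof. by rewrite /gamma_kernel => ->. Qed.

Lemma measurable_gamma_kernel a : measurable_fun [set: R] (gamma_kernel a).
Proof.
apply: measurable_fun_ifT => //; first exact: measurable_fun_ltr.
by apply: measurable_funM => //; exact: measurableT_comp.
Qed.

Lemma continuous_powR (a x : R) : 0 < x -> {for x, continuous (fun y => y `^ a)}.
Proof.
move=> x0; apply/differentiable_continuous/derivable1_diffP.
by have := @derivable_powR R 1 a x; rewrite in_itv/= andbT; exact.
Qed.

Lemma continuous_gamma_kernel a x : 0 < x -> {for x, continuous (gamma_kernel a)}.
Proof.
move=> x0.
have cw : {for x, continuous (fun y : R => y `^ (a - 1) * expR (- y))}.
  apply: cvgM; first exact: continuous_powR.
  apply: (@continuous_comp _ _ _ (-%R) expR); first exact: opp_continuous.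
  exact: continuous_expR.
suff : gamma_kernel a y @[y --> x] --> gamma_kernel a x by [].
rewrite gamma_kernelE//; apply: cvg_trans cw; apply: near_eq_cvg.
by near=> y; rewrite gamma_kernelE//; near: y; exact: lt_nbhsr.
Unshelve. all: by end_near. Qed.

(** Raise x / s <= exp (x / s) to the power s. The bound is not sharp, but any constant will do. *)
Lemma powR_expRN_le (s x : R) : 0 < s -> 0 < x -> x `^ s * expR (- x) <= s `^ s.
Proof.
move=> s0 x0; rewrite expRN ler_pdivrMr ?expR_gt0//.
have -> : expR x = expR (x / s) `^ s by rewrite -expRM divfK ?gt_eqF.
rewrite -powRM ?expR_ge0//; last exact: ltW.
apply: (ge0_ler_powR (ltW s0)); rewrite ?nnegrE; [exact: ltW| |].
  by rewrite mulr_ge0 ?expR_ge0// ltW.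
rewrite mulrC -ler_pdivrMr// (le_trans _ (expR_ge1Dx _))//; lra.
Qed.

(** The exponential absorbs the surplus factor x^(a-z), so the bound holds on all of (0, oo) and not
    only near 0. *)
Lemma gamma_kernel_le (a z x : R) : z < a -> 0 < x ->
  gamma_kernel a x <= (a - z) `^ (a - z) * x `^ (z - 1).
Proof.
move=> za x0; rewrite gamma_kernelE//.
rewrite (_ : a - 1 = (a - z) + (z - 1)); last by ring.
rewrite (@powRD _ x (a - z) (z - 1)) ?(gt_eqF x0) ?implybT// mulrAC ler_wpM2r ?powR_ge0//.
by rewrite powR_expRN_le// subr_gt0.
Qed.

Lemma gamma_kernel_ge (a x : R) : 0 < x <= 1 ->
  expR (- 1) * x `^ (a - 1) <= gamma_kernel a x.
Proof.
move=> /andP[x0 x1]; rewrite gamma_kernelE// mulrC ler_wpM2l ?powR_ge0//.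
by rewrite ler_expR lerN2.
Qed.

End gamma_kernel.

(** * Finiteness of gamma integrals *)

Section gamma_integral.
Context {R : realType}.
Local Notation mu := (@lebesgue_measure R).

Lemma powRDpos (x r s : R) : 0 < x -> x `^ (r + s) = x `^ r * x `^ s.
Proof. by move=> x0; rewrite powRD// (gt_eqF x0) implybT. Qed.

Lemma powRB1 (x r : R) : 0 < x -> x `^ (r - 1) = x `^ r / x.
Proof. by move=> x0; rewrite powRDpos// powR_inv1// ltW. Qed.

(** The antiderivative is x^c / c; staying above [e] avoids the singularity at 0 that occurs for c <
    1. *)
Lemma integral_powR_itv (c e : R) : 0 < c -> 0 < e < 1 ->
  (\int[mu]_(x in `[e, 1%R]) (x `^ (c - 1))%:E <= (c^-1)%:E)%E.
Proof.
move=> c0 /andP[e0 e1].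
have xgt0 x : x \in `[e, 1%R] -> 0 < x.
  by rewrite in_itv/= => /andP[ex _]; exact: lt_le_trans ex.
pose F x := c^-1 * x `^ c.
have cF x : 0 < x -> {for x, continuous F}.
  by move=> x0; apply: cvgM; [exact: cvg_cst|exact: continuous_powR].
have dp x : 0 < x -> derivable (fun x => x `^ c) x 1.
  by move=> x0; have := @derivable_powR R 1 c x; rewrite in_itv/= andbT; exact.
rewrite (@continuous_FTC2 _ _ F)//.
- by rewrite -EFinB lee_fin /F powR1 mulr1 lerBlDr lerDl mulr_ge0 ?powR_ge0// invr_ge0 ltW.
- apply: continuous_in_subspaceT => x; rewrite inE/= => /xgt0 x0.
  exact: continuous_powR.
- split.
  + move=> x /subset_itv_oo_cc/xgt0 x0; apply: derivableM => //; exact: dp.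
  + by apply: cvg_at_right_filter; exact: cF.
  + by apply: cvg_at_left_filter; exact: cF.
- move=> x /subset_itv_oo_cc/xgt0 x0.
  rewrite derive1E deriveZ/=; last exact: dp.
  rewrite -derive1E powR_derive1 ?in_itv/= ?x0//.
  by rewrite /GRing.scale/= mulrA mulVf ?mul1r// gt_eqF.
Qed.

Lemma integral_powR01 (c : R) : 0 < c ->
  (\int[mu]_(x in `]0%R, 1%R]) (x `^ (c - 1))%:E <= (c^-1)%:E)%E.
Proof.
move=> c0.
(* The exhaustion starts at 1/2, as the bound on [[e, 1]] asks for e < 1. *)
have e01 (n : nat) : 0 < (n.+2%:R^-1 : R) < 1.
  by rewrite invr_gt0 ltr0n/= invf_lt1 ?ltr0n// ltr1n.
have -> : `]0%R, 1%R]%classic = \bigcup_n `[n.+2%:R^-1, 1%R]%classic :> set R.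
  apply/seteqP; split=> [x|x [n _]] /=; rewrite !in_itv/= => /andP[h1 h2].
    have [n hn] : exists n : nat, x^-1 < n.+2%:R.
      exists (Num.truncn (x^-1)); rewrite (lt_trans (truncnS_gt _))//.
      by rewrite ltr_nat.
    exists n => //=; rewrite in_itv/= h2 andbT.
    by rewrite -[leRHS]invrK lef_pV2 ?posrE ?ltr0n ?invr_gt0// ltW.
  by rewrite h2 andbT (lt_le_trans _ h1)// invr_gt0 ltr0n.
have mp (D : set R) : measurable D -> measurable_fun D (fun x : R => (x `^ (c - 1))%:E).
  by move=> mD; apply/measurable_EFinP; exact: measurable_funTS.
pose F (n : nat) : set R := `[n.+2%:R^-1, 1%R]%classic.
have cv : ((\int[mu]_(x in F n) (x `^ (c - 1))%:E)%E @[n --> \oo] -->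
    (\int[mu]_(x in \bigcup_n F n) (x `^ (c - 1))%:E)%E).
  apply: ge0_nondecreasing_set_cvg_integral.
  - move=> n m nm; apply/subsetPset => x; rewrite /F/=; rewrite !in_itv/= => /andP[h1 ->].
    by rewrite andbT (le_trans _ h1)// lef_pV2 ?posrE ?ltr0n// ler_nat.
  - by move=> n; exact: measurable_itv.
  - by move=> n; apply: mp; exact: measurable_itv.
  - by move=> n x _; rewrite lee_fin powR_ge0.
by apply: (cvge_le _ cv); apply: nearW => n; exact: integral_powR_itv.
Qed.

(** On (0, 1] the kernel of shape c is at most x^(c-1), which is integrable; beyond 1 it is at most
    the kernel of shape b. Finiteness thus passes from b to every smaller positive shape. *)
Lemma integral_gamma_kernel_lty (b c : R) : 0 < c <= b ->
  (\int[mu]_x (gamma_kernel b x)%:E < +oo)%E ->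
  (\int[mu]_x (gamma_kernel c x)%:E < +oo)%E.
Proof.
move=> /andP[c0 cb] boo.
pose g (x : R) : \bar R := ((fun x => (x `^ (c - 1))%:E) \_ `]0%R, 1%R]) x.
have mg : measurable_fun [set: R] g.
  apply/(measurable_restrictT _ _).1 => //.
  by apply/measurable_EFinP; exact: measurable_funTS.
have g0 x : (0 <= g x)%E by rewrite /g patchE; case: ifP => // _; rewrite lee_fin powR_ge0.
have mG a : measurable_fun [set: R] (fun x : R => (gamma_kernel a x)%:E).
  by apply/measurable_EFinP; exact: measurable_gamma_kernel.
have G0 a x : (0 <= (gamma_kernel a x)%:E)%E by rewrite lee_fin gamma_kernel_ge0.
apply: (@le_lt_trans _ _ (\int[mu]_x (g x + (gamma_kernel b x)%:E))%E).
  apply: ge0_le_integral => //; [exact: mG|exact: emeasurable_funD mg (mG b)|].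
  move=> x _; rewrite /g patchE.
  have [x0|x0] := leP x 0.
    by rewrite (gamma_kernel_le0 c)// adde_ge0//; case: ifP => // _; rewrite lee_fin powR_ge0.
  rewrite mem_setE in_itv/= x0/=; have [x1|x1] := leP x 1.
    rewrite -EFinD lee_fin ler_wpDr ?gamma_kernel_ge0//.
    rewrite gamma_kernelE// ler_piMr ?powR_ge0//.
    by rewrite expR_le1 oppr_le0 ltW.
  rewrite add0e lee_fin !gamma_kernelE// ler_wpM2r ?expR_ge0//.
  by rewrite ler_powR// ?lerB// ltW.
rewrite ge0_integralD//; last exact: mG.
rewrite lte_add_pinfty//.
rewrite /g -integral_mkcond; apply: le_lt_trans (ltry c^-1).
exact: integral_powR01.
Qed.

End gamma_integral.

(** * Sums *)

Section gamma_sum.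
Context {R : realType} {d} {T : measurableType d} (P : probability T R).
Local Notation mu := (@lebesgue_measure R).

(** The constant is existential, so that absorbing a summand does not require an explicit
    normalisation. *)
Definition gamma_class (s : R) (f : R -> R) : Prop :=
  0 < s /\ exists2 C, 0 < C & forall x, f x = C * gamma_kernel s x.

(** The integrand of the Euler Beta integral, extended by zero outside (0, 1). *)
Let beta_kernel (a b t : R) : R :=
  if (0 < t) && (t < 1) then (1 - t) `^ (a - 1) * t `^ (b - 1) else 0.

Let beta_kernel_ge0 a b t : 0 <= beta_kernel a b t.
Proof. by rewrite /beta_kernel; case: ifP => // _; rewrite mulr_ge0 ?powR_ge0. Qed.

Let measurable_beta_kernel a b : measurable_fun [set: R] (beta_kernel a b).
Proof.
apply: measurable_fun_ifT => //.
  by apply: measurable_and; exact: measurable_fun_ltr.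
apply: measurable_funM => //.
apply: (measurableT_comp (@measurable_powR R (a - 1))).
exact: measurable_funB.
Qed.

(** The exponentials recombine to exp (-x) and the powers of x to x^(a+b-2), which leaves a function
    of t alone. Outside (0, 1) one of the two kernels on the left vanishes. *)
Lemma gamma_kernel_convolution (a b x t : R) : 0 < x ->
  gamma_kernel a (x - x * t) * gamma_kernel b (x * t) =
  gamma_kernel (a + b) x / x * beta_kernel a b t.
Proof.
move=> x0; rewrite /beta_kernel.
have [t0|t0] := leP t 0.
  by rewrite (gamma_kernel_le0 b) ?mulr0//= pmulr_rle0.
have [t1|t1] := ltP t 1; last first.
  by rewrite gamma_kernel_le0 ?mul0r ?mulr0//= subr_le0 ler_peMr// ltW.
have u0 : 0 < 1 - t by rewrite subr_gt0.
rewrite -{1}[x]mulr1 -mulrBr !gamma_kernelE// ?mulr_gt0//.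
rewrite !powRM ?ltW//= !powRB1// powRDpos//.
rewrite (_ : expR (- x) = expR (- (x * (1 - t))) * expR (- (x * t))); last first.
  by rewrite -expRD; congr expR; ring.
have [n1 n2 n3] : [/\ x != 0, t != 0 & 1 - t != 0] by rewrite !gt_eqF.
by field; rewrite n1 n2 n3.
Qed.

Lemma gamma_sum (U V : {mfun T >-> R}) (a b : R) (f g : R -> R) :
  (forall A B, measurable A -> measurable B ->
    P (U @^-1` A `&` V @^-1` B) = (P (U @^-1` A) * P (V @^-1` B))%E) ->
  full_density P U f -> full_density P V g ->
  gamma_class a f -> gamma_class b g ->
  exists h, full_density P (fun w => U w + V w) h /\ gamma_class (a + b) h.
Proof.
move=> ind [mf f0 fN fE] [mg g0 gN gE] [a0 [C1 C10 fC]] [b0 [C2 C20 gC]].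
pose B := (\int[mu]_t (beta_kernel a b t)%:E)%E.
pose w x := C1 * C2 * gamma_kernel (a + b) x.
have w0 x : 0 <= w x by rewrite !mulr_ge0 ?gamma_kernel_ge0// ltW.
have mw : measurable_fun [set: R] w.
  by apply: measurable_funM => //; exact: measurable_gamma_kernel.
have B0 : (0 <= B)%E by apply: integral_ge0 => t _; rewrite lee_fin beta_kernel_ge0.
have mphi : measurable_fun [set: R * R] (fun z => f (z.2 - z.1)).
  apply: (measurableT_comp mf); apply: measurable_funB.
    exact: measurable_snd.
  exact: measurable_fst.
(* [B] may still be infinite here, hence the extended product. The factor x from the substitution v
   = x t cancels the 1 / x of the kernel identity. *)
have HE x : (\int[mu]_v (f (x - v) * g v)%:E = (w x)%:E * B)%E.
  have [x0|x0] := leP x 0.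
    rewrite /w gamma_kernel_le0// mulr0 mul0e integral0_eq// => v _.
    have [v0|v0] := leP v 0; first by rewrite gN// mulr0.
    by rewrite fN ?mul0r//; lra.
  rewrite (ge0_integral_affine x 0)//; last 2 first.
  - apply/measurable_EFinP; apply: measurable_funM => //.
    by apply: (measurableT_comp mf); exact: measurable_funB.
  - by move=> v; rewrite lee_fin mulr_ge0.
  under eq_integral => t _.
    rewrite addr0 fC gC mulrACA gamma_kernel_convolution// mulrA mulrA -/(w x) EFinM.
    over.
  rewrite ge0_integralZl_EFin//; last 3 first.
  - by move=> t _; rewrite lee_fin beta_kernel_ge0.
  - by apply/measurable_EFinP; exact: measurable_beta_kernel.
  - by rewrite divr_ge0// ltW.
  by rewrite muleA -EFinM mulrC divfK ?gt_eqF.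
have dens A : measurable A ->
    P ((fun w => U w + V w) @^-1` A) = (\int[mu]_(x in A) ((w x)%:E * B))%E.
  move=> mA; under eq_integral do rewrite -HE.
  apply: (@independent_density _ _ _ P U V +%R f g (fun z => f (z.2 - z.1))) => //.
    by apply: measurable_funD; [exact: measurable_fst|exact: measurable_snd].
  move=> v D v0 mD /=.
  have mI : measurable_fun [set: R] (\1_D : R -> R) by exact: (@measurable_indic _ R R).
  rewrite [RHS](ge0_integral_affine 1 v)//; last 2 first.
  - apply/measurable_EFinP; apply: measurable_funM => //.
    by apply: (measurableT_comp mf); exact: measurable_funB.
  - by move=> x; rewrite lee_fin mulr_ge0.
  by rewrite mul1e; apply: eq_integral => x _; rewrite mul1r addrK.
have intw : ((\int[mu]_x (w x)%:E) * B = 1)%E.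
  rewrite -ge0_integralZr//; last 2 first.
  - exact/measurable_EFinP.
  - by move=> x _; rewrite lee_fin.
  by rewrite -dens// preimage_setT probability_setT.
(* An infinite [B] would make the total mass 0 or infinite, according to whether the integral of [w]
   vanishes; a zero [B] would make it 0. *)
have Bfin : B \is a fin_num.
  rewrite ge0_fin_numE// ltey; apply/eqP => Boo; move: intw; rewrite Boo.
  have := integral_ge0 mu (fun x (_ : [set: R] x) => w0 x : (0 <= (w x)%:E)%E).
  rewrite le_eqVlt => /predU1P[<-|i0]; first by rewrite mul0e => /eqP; rewrite eqe eq_sym oner_eq0.
  by rewrite gt0_muley.
have Bpos : 0 < fine B.
  rewrite lt_neqAle fine_ge0// andbT eq_sym; apply/eqP => B00.
  move: intw; rewrite -(fineK Bfin) B00 mule0 => /eqP.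
  by rewrite eqe eq_sym oner_eq0.
exists (fun x => C1 * C2 * fine B * gamma_kernel (a + b) x); split; last first.
  by split; [exact: addr_gt0|exists (C1 * C2 * fine B) => //; rewrite !mulr_gt0].
split.
- by apply: measurable_funM => //; exact: measurable_gamma_kernel.
- by move=> x; rewrite !mulr_ge0 ?gamma_kernel_ge0// ltW.
- by move=> x x0; rewrite gamma_kernel_le0// mulr0.
- move=> A mA; rewrite dens//; apply: eq_integral => x _.
  by rewrite -(fineK Bfin) -EFinM /w mulrAC.
Qed.

End gamma_sum.

(** * Products *)

Section power_class.
Context {R : realType}.
Local Notation mu := (@lebesgue_measure R).

(** The upper bound is imposed on all of (0, oo) because the convolution evaluates [f] at x / v,
    which ranges over every positive value. *)
Definition power_class (m : R) (f : R -> R) : Prop :=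
  [/\ 0 < m, forall x, 0 < x -> {for x, continuous f},
    forall z, 0 < z < m -> exists C, forall x, 0 < x -> f x <= C * x `^ (z - 1) &
    exists2 c, 0 < c & forall x, 0 < x <= 1 -> c * x `^ (m - 1) <= f x].

Lemma gamma_power_class s f : gamma_class s f -> power_class s f.
Proof.
move=> [s0 [C C0 fC]]; have -> : f = (fun x => C * gamma_kernel s x) by exact/funext.
split=> //.
- by move=> x x0; apply: cvgM; [exact: cvg_cst|exact: continuous_gamma_kernel].
- move=> z /andP[_ zs]; exists (C * (s - z) `^ (s - z)) => x x0.
  by rewrite -mulrA ler_wpM2l ?gamma_kernel_le// ltW.
- exists (C * expR (- 1)); first by rewrite mulr_gt0// expR_gt0.
  by move=> x x01; rewrite -mulrA ler_wpM2l ?gamma_kernel_ge// ltW.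
Qed.

Lemma le_integral_itv (k : R -> R) (K p q : R) : p < q ->
  measurable_fun [set: R] k -> (forall x, 0 <= k x) ->
  (forall x, p <= x <= q -> K <= k x) ->
  ((K * (q - p))%:E <= \int[mu]_x (k x)%:E)%E.
Proof.
move=> pq mk k0 kK.
have [K0|K0] := leP K 0.
  apply: (@le_trans _ _ 0%E); last by apply: integral_ge0 => x _; rewrite lee_fin.
  by rewrite lee_fin mulr_le0_ge0// subr_ge0 ltW.
have -> : ((K * (q - p))%:E = \int[mu]_(x in `[p, q]) (cst K%:E) x)%E.
  have mupq : mu `[p, q]%classic = (q - p)%:E by rewrite lebesgue_measure_itv/= lte_fin pq.
  by rewrite integral_cst// [X in (_ * X)%E]mupq.
apply: (@le_trans _ _ (\int[mu]_(x in `[p, q]) (k x)%:E)%E).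
  apply: ge0_le_integral => //.
  - by move=> x _; rewrite lee_fin ltW.
  - by apply/measurable_EFinP; exact: measurable_funTS.
by apply: ge0_subset_integral => //; [exact/measurable_EFinP|move=> x _; rewrite lee_fin].
Qed.

(** If [f] is the pure power x^(z-1), the integrand f (x / v) / v times the kernel of shape b
    separates into x^(z-1) and the kernel of shape b - z. Power bounds on [f] thus become gamma
    kernels in v. *)
Lemma powRV_gamma_kernel (b z x v : R) : 0 < x -> 0 < v ->
  (x * v `^ (-1)) `^ (z - 1) * v `^ (-1) * gamma_kernel b v =
  x `^ (z - 1) * gamma_kernel (b - z) v.
Proof.
move=> x0 v0; rewrite !gamma_kernelE// powRM ?powR_ge0//; last exact: ltW.
rewrite -powRrM -!mulrA; congr (_ * _); rewrite !mulrA; congr (_ * _).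
by rewrite -!powRDpos//; congr (_ `^ _); ring.
Qed.

End power_class.

(** * The density of a product with a gamma factor *)

Section quotient_convolution.
Context {R : realType}.
Local Notation mu := (@lebesgue_measure R).
Variables (m b C2 : R) (f : R -> R).
Hypotheses (fm : power_class m f) (b0 : 0 < b) (C20 : 0 < C2).
Hypotheses (mf : measurable_fun [set: R] f) (f0 : forall x, 0 <= f x).
Hypothesis fN : forall x, x <= 0 -> f x = 0.
Hypothesis boo : (\int[mu]_x (gamma_kernel b x)%:E < +oo)%E.

(* [v `^ (-1)] stands for [v^-1] because measurability is available for [powR].
   The two differ at [v < 0], where the gamma kernel vanishes. *)
Let k x v := f (x * v `^ (-1)) * (v `^ (-1) * (C2 * gamma_kernel b v)).

Let k0 x v : 0 <= k x v.
Proof. by rewrite !mulr_ge0 ?powR_ge0 ?gamma_kernel_ge0// ltW. Qed.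

Let kN x v : x <= 0 -> k x v = 0.
Proof. by move=> x0; rewrite /k fN ?mul0r// mulr_le0_ge0// powR_ge0. Qed.

Let mk2 : measurable_fun [set: R * R] (fun z => k z.1 z.2).
Proof.
have mp : measurable_fun [set: R * R] (fun z : R * R => z.2 `^ (-1)).
  exact: (measurableT_comp (@measurable_powR R (-1)) measurable_snd).
apply: measurable_funM.
  by apply: (measurableT_comp mf); apply: measurable_funM => //; exact: measurable_fst.
apply: measurable_funM => //; apply: measurable_funM => //.
exact: (measurableT_comp (measurable_gamma_kernel b) measurable_snd).
Qed.

Let mk x : measurable_fun [set: R] (k x).
Proof. exact: (measurable_fun_pair2 x mk2). Qed.

Let C2_ge0 : 0 <= C2.
Proof. exact: ltW. Qed.

Let kE C z x v : 0 < x -> 0 < v ->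
  C * C2 * x `^ (z - 1) * gamma_kernel (b - z) v =
  C * (x * v `^ (-1)) `^ (z - 1) * (v `^ (-1) * (C2 * gamma_kernel b v)).
Proof.
move=> x0 v0; rewrite -(mulrA (C * C2)) -powRV_gamma_kernel//; ring.
Qed.

Let k_le z C x v : 0 < x -> (forall x, 0 < x -> f x <= C * x `^ (z - 1)) ->
  k x v <= C * C2 * x `^ (z - 1) * gamma_kernel (b - z) v.
Proof.
move=> x0 fC; have [v0|v0] := leP v 0.
  by rewrite /k !gamma_kernel_le0// !mulr0.
rewrite kE// /k ler_wpM2r ?mulr_ge0 ?powR_ge0 ?gamma_kernel_ge0//.
by rewrite fC// mulr_gt0// powR_gt0.
Qed.

(** The condition x <= v places x / v in (0, 1], where the lower bound on [f] is available. *)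
Let k_ge c x v : 0 < x -> x <= v ->
  (forall x, 0 < x <= 1 -> c * x `^ (m - 1) <= f x) ->
  c * C2 * x `^ (m - 1) * gamma_kernel (b - m) v <= k x v.
Proof.
move=> x0 xv fc; have v0 : 0 < v by exact: lt_le_trans xv.
rewrite kE// /k ler_wpM2r ?mulr_ge0 ?powR_ge0 ?gamma_kernel_ge0//.
by rewrite fc// mulr_gt0 ?powR_gt0//= powR_inv1 ?(ltW v0)// ler_pdivrMr// mul1r.
Qed.

Let gamma_integrable z : 0 < z -> z < b ->
  mu.-integrable [set: R] (fun v => (gamma_kernel (b - z) v)%:E).
Proof.
move=> z0 zb; apply/integrableP; split.
  by apply/measurable_EFinP; exact: measurable_gamma_kernel.
under eq_integral do rewrite gee0_abs ?lee_fin ?gamma_kernel_ge0//.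
by apply: integral_gamma_kernel_lty boo; rewrite subr_gt0 zb/= gerBl ltW.
Qed.

(** An exponent below m gives a power bound on [f]; being also below b, it leaves a positive shape b
    - z and hence an integrable majorant. *)
Let exists_between : exists z, [/\ 0 < z, z < m & z < b].
Proof.
have [m0 _ _ _] := fm; case: (leP m b) => mb.
  by exists (m / 2); split; lra.
by have b_gt0 := b0; exists (b / 2); split; lra.
Qed.

Let k_integrable x : mu.-integrable [set: R] (EFin \o k x).
Proof.
have [x0|x0] := leP x 0.
  apply/integrableP; split; first by apply/measurable_EFinP; exact: mk.
  by rewrite integral0_eq ?ltry// => v _ /=; rewrite kN// normr0.
have [m0 _ fub _] := fm.
have [z [z0 zm zb]] := exists_between.
have [|C fC] := fub z; first by rewrite z0.
apply: le_integrable (integrableZl _ (C * C2 * x `^ (z - 1)) (gamma_integrable z z0 zb)) => //.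
- by apply/measurable_EFinP; exact: mk.
- move=> v _ /=; rewrite ger0_norm// lee_fin (le_trans (k_le z C x v x0 fC))//.
  exact: ler_norm.
Qed.

(** The multiplicative (Mellin) convolution of [f] with [C2] times the kernel of shape [b]. It is
    real-valued; integrability of [k x] ensures that nothing is lost. *)
Definition quotient_convolution x := \int[mu]_v k x v.

Lemma quotient_convolutionE x :
  (quotient_convolution x)%:E = (\int[mu]_v (k x v)%:E)%E.
Proof. by rewrite fineK//; apply: integrable_fin_num => //; exact: k_integrable. Qed.

Lemma quotient_convolution_ge0 x : 0 <= quotient_convolution x.
Proof. by rewrite -lee_fin quotient_convolutionE integral_ge0// => v _; rewrite lee_fin. Qed.

Lemma quotient_convolution_le0 x : x <= 0 -> quotient_convolution x = 0.
Proof.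
move=> x0; apply/EFin_inj; rewrite quotient_convolutionE integral0_eq// => v _.
by rewrite kN.
Qed.

Lemma measurable_quotient_convolution : measurable_fun [set: R] quotient_convolution.
Proof.
apply/measurable_EFinP.
rewrite (_ : _ \o _ = fubini_F mu (fun z => (k z.1 z.2)%:E)); last first.
  by apply/funext => x; exact: quotient_convolutionE.
apply: measurable_fun_fubini_tonelli_F => [|z]; last by rewrite lee_fin.
by apply/measurable_EFinP; exact: mk2.
Qed.

(** Continuity follows by dominated convergence, the upper bounds by integrating the majorant of
    [k], and the lower bound by keeping only a window of values of v. *)
Lemma quotient_convolution_power_class :
  power_class (Num.min m b) quotient_convolution.
Proof.
have [m0 cf fub [c c0 fc]] := fm.
split; first by rewrite lt_min m0.
- move=> x x0.
  have [z [z0 zm zb]] := exists_between.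
  have [|C fC] := fub z; first by rewrite z0.
  have C0 : 0 <= C by have := fC 1 ltr01; rewrite powR1 mulr1; exact: le_trans.
  (* On (x/2, 2x), writing y^(z-1) as y^z / y bounds it by (2x)^z / (x/2) whatever the sign of z -
     1. *)
  pose K := C * C2 * ((2 * x) `^ z / (x / 2)).
  suff : {in (`](x / 2), (2 * x)[%classic : set R),
      continuous (fun y => \int[mu]_(v in [set: R]) k y v)}.
    by apply; rewrite inE/= in_itv/=; apply/andP; split; lra.
  apply: (@continuity_under_integral _ _ _ mu k setT measurableT (x / 2) (2 * x) _ _
     (fun v => K * gamma_kernel (b - z) v)).
  + by move=> y _; exact: k_integrable.
  + apply: aeW => v _ y; rewrite inE/= in_itv/= => /andP[xy yx].
    have y0 : 0 < y by lra.
    have [v0|v0] := leP v 0.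
      rewrite (_ : k^~ v = cst 0); first exact: cvg_cst.
      by apply/funext => w; rewrite /k gamma_kernel_le0// !mulr0.
    have cq : {for y, continuous (f \o (fun y => y * v `^ (-1)))}.
      apply: continuous_comp; first by apply: cvgM; [exact: cvg_id|exact: cvg_cst].
      by apply: cf; rewrite mulr_gt0// powR_gt0.
    by apply: cvgM; [exact: cq|exact: cvg_cst].
  + exact: (integrableZl measurableT K (gamma_integrable z z0 zb)).
  + move=> y; rewrite /= in_itv/= => /andP[xy yx]; apply: aeW => v _.
    have y0 : 0 < y by lra.
    rewrite ger0_norm// (le_trans (k_le z C y v y0 fC))//.
    rewrite ler_wpM2r ?gamma_kernel_ge0// ler_wpM2l ?mulr_ge0//.
    rewrite powRB1// ler_pM ?powR_ge0 ?invr_ge0//; [exact: ltW| |].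
      by rewrite ge0_ler_powR ?nnegrE//; lra.
    by rewrite lef_pV2 ?posrE//; lra.
- move=> z /andP[z0]; rewrite lt_min => /andP[zm zb].
  have [|C fC] := fub z; first by rewrite z0.
  exists (C * C2 * fine (\int[mu]_v (gamma_kernel (b - z) v)%:E)%E) => x x0.
  have gi := gamma_integrable z z0 zb.
  rewrite -lee_fin quotient_convolutionE mulrAC EFinM fineK; last exact: integrable_fin_num.
  rewrite -integralZl//; apply: ge0_le_integral => //.
  + by move=> v _; rewrite lee_fin.
  + by apply/measurable_EFinP; exact: mk.
  + by move: (integrableZl measurableT (C * C2 * x `^ (z - 1)) gi) => /integrableP[].
  + by move=> v _; rewrite -EFinM lee_fin k_le.
- (* The mass comes from [v] of order 1 if [m <= b], and of order [x] if [b < m]. *)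
  case: (leP m b) => mb.
  (* On [1, 2], v^(b-m-1) >= 1/v >= 1/2 because b >= m, and exp (-v) >= exp (-2). *)
  + exists (c * C2 * (expR (- 2) / 2)); first by rewrite !mulr_gt0 ?expR_gt0.
    move=> x /andP[x0 x1]; rewrite -lee_fin quotient_convolutionE.
    have := @le_integral_itv _ (k x) (c * C2 * (expR (- 2) / 2) * x `^ (m - 1)) 1 2.
    rewrite (_ : 2 - 1 = 1 :> R) ?mulr1; last by ring.
    apply=> //; first by rewrite ltr1n.
    move=> v /andP[v1 v2]; apply: le_trans (k_ge _ _ _ x0 (le_trans x1 v1) fc).
    have v0 : 0 < v by lra.
    rewrite mulrAC ler_wpM2l ?mulr_ge0 ?powR_ge0 ?(ltW c0)// gamma_kernelE// mulrC.
    apply: ler_pM; rewrite ?expR_ge0 ?invr_ge0//; last by rewrite ler_expR lerN2.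
    apply: (@le_trans _ _ (v `^ (-1))); first by rewrite powR_inv1 ?(ltW v0)// lef_pV2 ?posrE.
    by rewrite ler_powR//; lra.
  (* On [x, 2x] the exponent b - m - 1 is negative, so v^(b-m-1) >= (2x)^(b-m-1), while exp (-v) >=
     exp (-2) since x <= 1. The window has length x, which raises the total power of x to b - 1. *)
  + exists (c * C2 * (expR (- 2) * 2 `^ (b - m - 1))).
      by rewrite !mulr_gt0 ?expR_gt0 ?powR_gt0.
    move=> x /andP[x0 x1]; rewrite -lee_fin quotient_convolutionE.
    have := @le_integral_itv _ (k x)
      (c * C2 * x `^ (m - 1) * (expR (- 2) * (2 * x) `^ (b - m - 1))) x (2 * x).
    rewrite (_ : 2 * x - x = x); last by ring.
    have -> : c * C2 * (expR (- 2) * 2 `^ (b - m - 1)) * x `^ (b - 1) =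
        c * C2 * x `^ (m - 1) * (expR (- 2) * (2 * x) `^ (b - m - 1)) * x.
      rewrite powRM ?(ltW x0)// (_ : b - 1 = (m - 1) + (b - m - 1) + 1); last by ring.
      by rewrite !(powRDpos x)// powRr1 ?(ltW x0)//; ring.
    apply=> //; first by lra.
    move=> v /andP[xv v2x]; apply: le_trans (k_ge _ _ _ x0 xv fc).
    have v0 : 0 < v by lra.
    rewrite ler_wpM2l ?mulr_ge0 ?powR_ge0 ?(ltW c0)// gamma_kernelE// mulrC.
    apply: ler_pM; rewrite ?expR_ge0 ?powR_ge0//; last by rewrite ler_expR; lra.
    rewrite -(opprK (b - m - 1)) !(powRN _ (- _)).
    rewrite lef_pV2 ?posrE ?powR_gt0//; last by lra.
    by rewrite ge0_ler_powR ?nnegrE//; lra.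
Qed.

End quotient_convolution.

(** Finiteness comes from the total mass 1 of the law rather than from an estimate of the
    integral. *)
Lemma gamma_class_integral {R : realType} {d} {T : measurableType d}
    (P : probability T R) (V : T -> R) (b : R) (g : R -> R) :
  full_density P V g -> gamma_class b g ->
  (\int[lebesgue_measure]_x (gamma_kernel b x)%:E < +oo)%E.
Proof.
move=> [mg g0 gN gE] [b0 [C C0 gC]].
have := gE _ measurableT; rewrite preimage_setT probability_setT.
under eq_integral do rewrite gC EFinM.
rewrite ge0_integralZl_EFin//; last 3 first.
- by move=> x _; rewrite lee_fin gamma_kernel_ge0.
- by apply/measurable_EFinP; exact: measurable_gamma_kernel.
- exact: ltW.
rewrite ltey => intE; apply/eqP => intoo; move: intE; rewrite intoo.
by rewrite gt0_muley.
Qed.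

(** For fixed v > 0, [U] times v has density f (x / v) / v; this is the [phi] of the general
    formula, and the substitution of v x for x verifies it. *)
Lemma gamma_product {R : realType} {d} {T : measurableType d} (P : probability T R)
    (U V : {mfun T >-> R}) (m b : R) (f g : R -> R) :
  (forall A B, measurable A -> measurable B ->
    P (U @^-1` A `&` V @^-1` B) = (P (U @^-1` A) * P (V @^-1` B))%E) ->
  full_density P U f -> full_density P V g ->
  power_class m f -> gamma_class b g ->
  exists h, full_density P (fun w => U w * V w) h /\ power_class (Num.min m b) h.
Proof.
move=> ind [mf f0 fN fE] Vg fm gb.
have boo := gamma_class_integral P V b g Vg gb.
have [mg g0 gN gE] := Vg; have [b0 [C2 C20 gC]] := gb.
exists (quotient_convolution b C2 f); split; last exact: quotient_convolution_power_class.
split.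
- exact: (@measurable_quotient_convolution _ m).
- by move=> x; exact: (@quotient_convolution_ge0 _ m).
- by move=> x; exact: (@quotient_convolution_le0 _ m).
move=> A mA.
under [RHS]eq_integral do rewrite (@quotient_convolutionE _ m)//.
have mp : measurable_fun [set: R * R] (fun z : R * R => z.1 `^ (-1)).
  exact: (measurableT_comp (@measurable_powR R (-1)) measurable_fst).
have mphi : measurable_fun [set: R * R] (fun z : R * R => f (z.2 * z.1 `^ (-1)) * z.1 `^ (-1)).
  apply: measurable_funM => //; apply: (measurableT_comp mf).
  by apply: measurable_funM => //; exact: measurable_snd.
rewrite (@independent_density _ _ _ P U V *%R f g
  (fun z => f (z.2 * z.1 `^ (-1)) * z.1 `^ (-1)))//.
- by apply: eq_integral => x _; apply: eq_integral => v _; rewrite gC mulrA.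
- by apply: measurable_funM; [exact: measurable_fst|exact: measurable_snd].
- by move=> z; rewrite mulr_ge0 ?powR_ge0.
move=> v D v0 mD.
have mI : measurable_fun [set: R] (\1_D : R -> R) by exact: (@measurable_indic _ R R).
rewrite [RHS](ge0_integral_affine v 0)//; last 2 first.
- apply/measurable_EFinP; apply: measurable_funM => //.
  exact: (measurable_fun_pair2 v mphi).
- by move=> x; rewrite lee_fin !mulr_ge0 ?powR_ge0.
have vV : v * v `^ (-1) = 1 by rewrite powR_inv1 ?ltW// mulfV ?gt_eqF.
have vx x : v * x * v `^ (-1) = x by rewrite mulrAC vV mul1r.
under [in RHS]eq_integral => x _.
  rewrite /= addr0 vx -mulrA mulrCA EFinM.
  over.
rewrite ge0_integralZl_EFin ?powR_ge0//; last 2 first.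
- by move=> x _; rewrite lee_fin mulr_ge0.
- apply/measurable_EFinP; apply: measurable_funM => //.
  by apply: (measurableT_comp mI); exact: mulrl_measurable.
by rewrite muleA -EFinM vV mul1e; apply: eq_integral => x _; rewrite (mulrC v).
Qed.

(** * Sparsity shape parameter *)

Section sparsity.
Context {R : realType}.
Local Notation mu := (@lebesgue_measure R).

Lemma eq_sparsity_shape (p q : R -> R) :
  (forall x, 0 < x -> p x = q x) -> sparsity_shape p = sparsity_shape q.
Proof.
have sub (p1 p2 : R -> R) : (forall x, 0 < x -> p1 x = p2 x) ->
    [set z : R | exists kappa : R, p1 x / x `^ (z - 1) @[x --> 0^'+] --> kappa] `<=`
    [set z : R | exists kappa : R, p2 x / x `^ (z - 1) @[x --> 0^'+] --> kappa].
  move=> p12 z [kappa cv]; exists kappa; apply: cvg_trans cv; apply: near_eq_cvg.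
  by near=> x; rewrite p12.
move=> pq; rewrite /sparsity_shape; congr (ereal_sup (EFin @` _)).
by apply/seteqP; split; apply: sub => // x x0; rewrite pq.
Unshelve. all: by end_near. Qed.

(** For z > m the lower bound excludes a finite limit, and for 0 < z < m the upper bounds give the
    limit 0. The case z = m stays undecided, which the supremum does not see. *)
Lemma sparsity_shape_power_class (m : R) (p : R -> R) :
  (forall x, 0 <= p x) -> power_class m p -> sparsity_shape p = m%:E.
Proof.
move=> p0 [m0 _ pub [c c0 pc]]; apply/eqP; rewrite eq_le; apply/andP; split.
  apply: ge_ereal_sup => _ [z [kappa cv] <-].
  rewrite lee_fin leNgt; apply/negP => mz.
  (* This function stays above [c] near [0]. *)
  have cv0 : x `^ (z - m) * (p x / x `^ (z - 1)) @[x --> 0^'+] --> 0 * kappa.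
    by apply: cvgM => //; apply: powR_cvg0; rewrite subr_gt0.
  suff : c <= 0 by rewrite leNgt c0.
  rewrite -(mul0r kappa); apply: (cvgr_to_ge cv0).
  near=> x.
  have x0 : 0 < x by [].
  have x1 : x <= 1 by near: x; apply: nbhs_right_le.
  have := pc x; rewrite x0 x1 => /(_ isT).
  rewrite -ler_pdivlMr ?powR_gt0// => /le_trans; apply.
  rewrite mulrCA ler_wpM2l//.
  rewrite (_ : z - 1 = (z - m) + (m - 1)); last by ring.
  by rewrite (@powRDpos _ x (z - m))// invfM mulrA mulfV ?mul1r// gt_eqF// powR_gt0.
apply/lee_addgt0Pr => e e0.
(* The minimum with m keeps z positive when e is large. *)
pose z := m - Num.min e m / 2.
have [z0 zm mze] : [/\ 0 < z, z < m & m <= z + e].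
  by rewrite /z; case: (leP e m) => ?; split; lra.
apply: (@le_trans _ _ (z%:E + e%:E)%E); first by rewrite -EFinD lee_fin.
rewrite leeD2r//; apply: ereal_sup_ubound; exists z => //; exists 0.
(* A second exponent strictly between z and m leaves the factor x^(z'-z), which tends to 0. *)
pose z' := (z + m) / 2.
have [|C pC] := pub z'; first by rewrite /z'; apply/andP; split; lra.
apply: (@squeeze_cvgr _ _ _ _ (fun=> 0) (fun x => C * x `^ (z' - z))).
- near=> x; have x0 : 0 < x by [].
  rewrite divr_ge0 ?powR_ge0//= ler_pdivrMr ?powR_gt0// -mulrA -powRDpos//.
  by rewrite (_ : z' - z + (z - 1) = z' - 1); [exact: pC|ring].
- exact: cvg_cst.
- rewrite -[X in _ --> X](mulr0 C); apply: cvgM; first exact: cvg_cst.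
  by apply: powR_cvg0; rewrite /z'; lra.
Unshelve. all: by end_near. Qed.

End sparsity.

(** * Uniqueness of a continuous density *)

Section uniqueness.
Context {R : realType} {d} {T : measurableType d} (P : probability T R).
Local Notation mu := (@lebesgue_measure R).

(** By continuity two levels [m1] < [m2] separate [q] from [p] on a closed interval around x. Both
    integrals over it equal the same probability, yet they differ by at least its length times m2 -
    m1. *)
Let density_not_lt (X : T -> R) (p q : R -> R) (x : R) :
  {in `]0%R, +oo[, continuous p} -> has_density_pos P X p ->
  {in `]0%R, +oo[, continuous q} -> has_density_pos P X q ->
  0 < x -> ~ q x < p x.
Proof.
move=> cp dp cq dq x0 qp.
have xin y : 0 < y -> y \in `]0%R, +oo[ by rewrite in_itv/= andbT.
pose m1 := (2 * q x + p x) / 3; pose m2 := (q x + 2 * p x) / 3.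
have [qm1 m12 m2p] : [/\ q x < m1, m1 < m2 & m2 < p x] by rewrite /m1 /m2; split; lra.
have cqx : q y @[y --> x] --> q x by exact/cq/xin.
have cpx : p y @[y --> x] --> p x by exact/cp/xin.
have : \forall y \near x, [/\ 0 < y, q y <= m1 & m2 <= p y].
  near=> y; split; near: y.
  - exact: lt_nbhsr.
  - exact: (cvgr_le (q x) cqx).
  - exact: (cvgr_ge (p x) cpx).
move=> /nbhs_ballP[e /= e0 he].
(* Halving the radius gives a compact interval inside the ball, of length exactly e; continuity on
   it provides integrability. *)
pose A : set R := `[x - e / 2, x + e / 2]%classic.
have Ae y : A y -> [/\ 0 < y, q y <= m1 & m2 <= p y].
  rewrite /A/= in_itv/= => /andP[y1 y2]; apply: he.
  by rewrite /ball/= ltr_norml; apply/andP; split; lra.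
have mA : measurable A by exact: measurable_itv.
have muA : mu A = e%:E.
  rewrite /A lebesgue_measure_itv/= lte_fin ifT; last by lra.
  by rewrite -EFinB; congr EFin; lra.
have A0 : A `&` `]0%R, +oo[ = A.
  by apply/setIidPl => y /Ae[y0 _ _] /=; rewrite in_itv/= y0.
have intA (r : R -> R) : {in `]0%R, +oo[, continuous r} -> mu.-integrable A (EFin \o r).
  move=> cr; apply: continuous_compact_integrable; first exact: segment_compact.
  apply: continuous_in_subspaceT => y; rewrite inE => /Ae[y0 _ _].
  by apply: cr; exact: xin.
have intc (r : R) : (\int[mu]_(y in A) (cst r%:E) y = (r * e)%:E)%E.
  by rewrite integral_cst// [X in (_ * X)%E]muA.
have finc (r : R) : mu.-integrable A (cst r%:E).
  by apply: (intA (cst r)) => y _; exact: cvg_cst.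
have pq : (\int[mu]_(y in A) (p y)%:E = \int[mu]_(y in A) (q y)%:E)%E.
  by have := dp A mA; rewrite dq// A0.
have : ((m2 * e)%:E <= (m1 * e)%:E)%E.
  rewrite -!intc; apply: (@le_trans _ _ (\int[mu]_(y in A) (p y)%:E)%E).
    by apply: le_integral => //; [exact: intA|move=> y; rewrite inE lee_fin => /Ae[]].
  by rewrite pq; apply: le_integral => //; [exact: intA|move=> y; rewrite inE lee_fin => /Ae[]].
by rewrite lee_fin ler_pM2r// leNgt m12.
Unshelve. all: by end_near. Qed.

Lemma continuous_density_unique (X : T -> R) (p q : R -> R) :
  {in `]0%R, +oo[, continuous p} -> has_density_pos P X p ->
  {in `]0%R, +oo[, continuous q} -> has_density_pos P X q ->
  forall x, 0 < x -> p x = q x.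
Proof.
move=> cp dp cq dq x x0; apply/eqP; rewrite eq_le !leNgt.
apply/andP; split; apply/negP.
  exact: (density_not_lt X p q x cp dp cq dq x0).
exact: (density_not_lt X q p x cq dq cp dp x0).
Qed.

Lemma full_density_pos (X : T -> R) (f : R -> R) :
  full_density P X f -> has_density_pos P X f.
Proof.
move=> [_ _ fN fE] A mA; rewrite fE// [RHS]integral_mkcondr.
apply: eq_integral => x _; rewrite patchE mem_setE in_itv/= andbT.
by case: ltP => // /fN ->.
Qed.

Lemma gamma_pdfE (a x : R) : gamma_pdf a x = (Gamma_fun a)^-1 * gamma_kernel a x.
Proof.
by rewrite /gamma_pdf /gamma_kernel; case: ifP; rewrite ?mulr0// mulrC.
Qed.

Lemma gamma_pdf_full_density (X : T -> R) (a : R) : 0 < a ->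
  has_density_pos P X (gamma_pdf a) ->
  full_density P X (gamma_pdf a) /\ gamma_class a (gamma_pdf a).
Proof.
move=> a0 dX.
have G0 : 0 <= Gamma_fun a.
  by apply: Rintegral_ge0 => x _; rewrite mulr_ge0 ?powR_ge0 ?expR_ge0.
have XE A : measurable A -> (P (X @^-1` A) = \int[mu]_(x in A) (gamma_pdf a x)%:E)%E.
  move=> mA; rewrite dX// integral_mkcondr; apply: eq_integral => x _.
  rewrite patchE mem_setE in_itv/= andbT; case: ltP => // x0.
  by rewrite gamma_pdfE gamma_kernel_le0// mulr0.
(* A zero inverse would make the density vanish, against total mass 1. This also excludes a
   divergent integral, which [Rintegral] sends to 0. *)
have Gpos : 0 < (Gamma_fun a)^-1.
  rewrite lt_neqAle invr_ge0 G0 andbT eq_sym; apply/eqP => G00.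
  have := XE _ measurableT; rewrite preimage_setT probability_setT.
  rewrite integral0_eq => [/eqP|x _]; first by rewrite eqe oner_eq0.
  by rewrite gamma_pdfE G00 mul0r.
have fE : gamma_pdf a = (fun x => (Gamma_fun a)^-1 * gamma_kernel a x).
  by apply/funext => x; exact: gamma_pdfE.
split; last by split=> //; exists (Gamma_fun a)^-1 => // x; exact: gamma_pdfE.
split=> //.
- by rewrite fE; apply: measurable_funM => //; exact: measurable_gamma_kernel.
- by move=> x; rewrite gamma_pdfE mulr_ge0 ?gamma_kernel_ge0// ltW.
- by move=> x x0; rewrite gamma_pdfE gamma_kernel_le0// mulr0.
Qed.

End uniqueness.

(** * Shape parameters of the product and of the sum *)

Section shape_of_density.
Context {R : realType} {d} {T : measurableType d} (P : probability T R).

Lemma sparsity_shape_of_density (X : T -> R) (m : R) (h : R -> R) :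
  full_density P X h -> power_class m h ->
  (exists p : R -> R, {in `]0%R, +oo[, continuous p} /\ has_density_pos P X p) /\
  (forall p : R -> R, {in `]0%R, +oo[, continuous p} -> has_density_pos P X p ->
    sparsity_shape p = m%:E).
Proof.
move=> dh ph; have dh' := full_density_pos P X h dh.
have ch : {in `]0%R, +oo[, continuous h}.
  by have [_ + _ _] := ph => ch x; rewrite in_itv/= andbT; exact: ch.
split; first by exists h.
move=> p cp dp.
have -> := eq_sparsity_shape p h (continuous_density_unique P X p h cp dp ch dh').
by apply: sparsity_shape_power_class => //; have [] := dh.
Qed.

End shape_of_density.

Theorem theorem1 (R : realType) (d : measure_display) (T : measurableType d)
  (P : probability T R) (K : nat) (lambda : 'I_K -> R)
  (eta : 'I_K -> {RV P >-> R}) :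
  (0 < K)%N ->
  (forall i, 0 < lambda i) ->
  mutually_independent P (fun i => eta i : T -> R) ->
  (forall i, has_density_pos P (eta i) (gamma_pdf (lambda i))) ->
  (* (i) product *)
  (let Psi := fun w => \prod_(i < K) eta i w in
   (exists p : R -> R, {in `]0%R, +oo[, continuous p} /\ has_density_pos P Psi p) /\
   (forall p : R -> R, {in `]0%R, +oo[, continuous p} -> has_density_pos P Psi p ->
      sparsity_shape p = \big[Order.min/+oo%E]_(i < K) (lambda i)%:E)) /\
  (* (ii) sum *)
  (let Psi := fun w => \sum_(i < K) eta i w in
   (exists p : R -> R, {in `]0%R, +oo[, continuous p} /\ has_density_pos P Psi p) /\
   (forall p : R -> R, {in `]0%R, +oo[, continuous p} -> has_density_pos P Psi p ->
      sparsity_shape p = (\sum_(i < K) lambda i)%:E)).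
Proof.
case: K lambda eta => [//|n] lambda eta _ l0 ind dens.
have meta i : measurable_fun [set: T] (eta i : T -> R) by exact: measurable_funPT.
have dG i : full_density P (eta i) (gamma_pdf (lambda i)) /\
    gamma_class (lambda i) (gamma_pdf (lambda i)).
  exact: gamma_pdf_full_density.
have dP i : exists g, full_density P (eta i) g /\ gamma_class (lambda i) g.
  by exists (gamma_pdf (lambda i)).
split=> Psi.
(* Labels are extended reals because the minimum needs +oo as neutral element; [D] and [G] force
   them to be finite. *)
- pose D (mu : \bar R) f := exists2 m, mu = m%:E & power_class m f.
  pose G (mu : \bar R) g := exists2 b, mu = b%:E & gamma_class b g.
  have [| |||h [dh [m -> Dh]]] := @density_big R d T P 1 *%R (\bar R) +oo%E
    (@Order.min _ (\bar R)) D G _ _ n (fun i => eta i : T -> R) (fun i => (lambda i)%:E) meta ind.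
  + exact: measurable_funM measurable_fst measurable_snd.
  + move=> U V _ _ f g iUV Uf Vg [m -> fm] [b -> gb].
    have [h [dh Dh]] := gamma_product P U V m b f g iUV Uf Vg fm gb.
    by exists h; split=> //; exists (Num.min m b) => //; rewrite EFin_min.
  + have [g [dg gg]] := dP ord0; exists g; split=> //; exists (lambda ord0) => //.
    exact: gamma_power_class.
  + move=> i; have [g [dg gg]] := dP (lift ord0 i); exists g; split=> //.
    by exists (lambda (lift ord0 i)).
  exact: sparsity_shape_of_density dh Dh.
(* For sums the accumulated density is again of gamma type, so [gamma_class] serves both as [D] and
   as [G]. *)
- have [| |||h [dh Dh]] := @density_big R d T P 0 +%R R 0 +%R
    gamma_class gamma_class _ _ n (fun i => eta i : T -> R) lambda meta ind.
  + exact: measurable_funD measurable_fst measurable_snd.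
  + by move=> U V a b f g iUV; exact: gamma_sum.
  + exact: dP.
  + by move=> i; exact: dP.
  by apply: sparsity_shape_of_density dh _; exact: gamma_power_class.
Qed.
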